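(* Let $R$ be a commutative ring with a unit and $n$ a positive integer. (1) The group $\mathrm{Hol}\bigl(\bigoplus_nR\bigr)$ is isomorphic to the subgroup of $GL(n+1,R)$ consisting of all the matrices of the form $$\begin{pmatrix}1&v\\ 0&M\end{pmatrix},\qquad v\in R^{1\times n}\text{ arbitrary},\ M \text{ an invertible } n\times n \text{ matrix over } R,$$ the group of automorphisms of $\bigoplus_{n+1}R$ fixing $e_1=(1,0,\ldots,0)^T$. (2) Alternatively, $\mathrm{Hol}\bigl(\bigoplus_nR\bigr)$ is isomorphic to the subgroup of $GL(n+1,R)$ consisting of all the matrices of the form $$\begin{pmatrix}1&0\\ w&M\end{pmatrix},\qquad w\in R^{n\times1}\text{ arbitrary},\ M \text{ an invertible } n\times n \text{ matrix over } R,$$ the stabilizer of a rank $n$ submodule of $\bigoplus_{n+1}R$.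
   Context: $\bigoplus_nR$ is the direct sum of $n$ copies of $R$, regarded as an $R$-module, and $\mathrm{Aut}(\bigoplus_nR)$ denotes its group of $R$-module automorphisms, which is isomorphic to $GL(n,R)$, the group of all invertible $n\times n$ matrices with entries in $R$. $\mathrm{Hol}(\bigoplus_nR)$ is the holomorph, i.e. the split extension of $\bigoplus_nR$ by $\mathrm{Aut}(\bigoplus_nR)$ consisting of pairs $(f,x)$ with $f\in\mathrm{Aut}(\bigoplus_nR)$, $x\in\bigoplus_nR$, and multiplication $(f,x)(g,y)=(fg,g^{-1}(x)+y)$.
   Formalization: In (2), ''the stabilizer of a rank n submodule'' N is read as the automorphisms that stabilize N and induce the identity on the quotient by N; the plain stabilizer also contains uI for every unit u (e.g. -I over the integers), which is not of the stated form unless u = 1. *)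

(* Defs.v *)
From HB Require Import structures.
From mathcomp Require Import all_boot all_order all_algebra.
From mathcomp Require Import boolp classical_sets.

Set Implicit Arguments.
Unset Strict Implicit.
Unset Printing Implicit Defensive.

Import GRing.Theory.

Local Open Scope ring_scope.
Local Open Scope classical_set_scope.

(* The ring is a [comPzRingType], so that the zero ring is allowed and no unit
   predicate has to be assumed on it. The (unique) two-sided inverse is stored
   next to the matrix; by [GL_inj] an element is determined by its matrix. *)
Record GL (R : comPzRingType) (n : nat) := MkGL {
  GL_mx :> 'M[R]_n;
  GL_invmx : 'M[R]_n;
  GL_mulmxV : GL_mx *m GL_invmx = 1%:M;
  GL_mulVmx : GL_invmx *m GL_mx = 1%:M }.

Section GeneralLinearGroup.
Variables (R : comPzRingType) (n : nat).
Implicit Types A B : GL R n.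

Lemma GL_inj A B : GL_mx A = GL_mx B -> A = B.
Proof.
case: A B => [a a' aa' a'a] [b b' bb' b'b] /= eab; subst b.
have e' : a' = b' by rewrite -[a']mulmx1 -bb' mulmxA a'a mul1mx.
by subst b'; congr MkGL.
Qed.

HB.instance Definition _ := gen_eqMixin (GL R n).
HB.instance Definition _ := gen_choiceMixin (GL R n).

Definition GL_one : GL R n := MkGL (mul1mx 1%:M) (mul1mx 1%:M).

Definition GL_inv A : GL R n := MkGL (GL_mulVmx A) (GL_mulmxV A).

Fact GL_mul_subproof A B :
  (A *m B) *m (GL_invmx B *m GL_invmx A) = 1%:M.
Proof. by rewrite -mulmxA (mulmxA (GL_mx B)) GL_mulmxV mul1mx GL_mulmxV. Qed.

Fact GL_mul_subproofV A B :
  (GL_invmx B *m GL_invmx A) *m (A *m B) = 1%:M.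
Proof. by rewrite -mulmxA (mulmxA _ (GL_mx A)) GL_mulVmx mul1mx GL_mulVmx. Qed.

Definition GL_mul A B : GL R n :=
  MkGL (GL_mul_subproof A B) (GL_mul_subproofV A B).

Fact GL_mulA : associative GL_mul.
Proof. by move=> A B C; apply: GL_inj; rewrite /= mulmxA. Qed.
Fact GL_mul1 : left_id GL_one GL_mul.
Proof. by move=> A; apply: GL_inj; rewrite /= mul1mx. Qed.
Fact GL_mul1r : right_id GL_one GL_mul.
Proof. by move=> A; apply: GL_inj; rewrite /= mulmx1. Qed.
Fact GL_mulV : left_inverse GL_one GL_inv GL_mul.
Proof. by move=> A; apply: GL_inj; rewrite /= GL_mulVmx. Qed.
Fact GL_mulVr : right_inverse GL_one GL_inv GL_mul.
Proof. by move=> A; apply: GL_inj; rewrite /= GL_mulmxV. Qed.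

HB.instance Definition _ :=
  isGroup.Build (GL R n) GL_mulA GL_mul1 GL_mul1r GL_mulV GL_mulVr.

End GeneralLinearGroup.

(* The inverse is again stored; by [lmodAut_inj] an automorphism is determined
   by its underlying function. *)
Record lmodAut (R : pzRingType) (V : lmodType R) := MkLmodAut {
  aut_fun :> {linear V -> V};
  aut_invfun : {linear V -> V};
  aut_funK : cancel aut_fun aut_invfun;
  aut_invfunK : cancel aut_invfun aut_fun }.

Section AutomorphismGroup.
Variables (R : pzRingType) (V : lmodType R).
Implicit Types f g : lmodAut V.

Lemma linear_funext (u v : {linear V -> V}) : u =1 v -> u = v.
Proof.
case: u v => [u [[u1] [u2]]] [v [[v1] [v2]]] /= /funext e; subst v.
by rewrite (Prop_irrelevance u1 v1) (Prop_irrelevance u2 v2).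
Qed.

Lemma lmodAut_inj f g : f =1 g -> f = g.
Proof.
case: f g => [a a' aK a'K] [b b' bK b'K] /= /linear_funext eab; subst b.
have e' : a' = b' by apply: linear_funext => x; rewrite -{1}[x]b'K aK.
by subst b'; congr MkLmodAut.
Qed.

HB.instance Definition _ := gen_eqMixin (lmodAut V).
HB.instance Definition _ := gen_choiceMixin (lmodAut V).

Definition aut_one : lmodAut V :=
  @MkLmodAut R V idfun idfun (fun=> erefl) (fun=> erefl).

Definition aut_inv f : lmodAut V := MkLmodAut (aut_invfunK f) (aut_funK f).

Definition aut_mul f g : lmodAut V :=
  @MkLmodAut R V (aut_fun f \o aut_fun g) (aut_invfun g \o aut_invfun f)
    (can_comp (aut_funK f) (aut_funK g))
    (can_comp (aut_invfunK g) (aut_invfunK f)).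

Fact aut_mulA : associative aut_mul.
Proof. by move=> f g h; apply: lmodAut_inj. Qed.
Fact aut_mul1 : left_id aut_one aut_mul.
Proof. by move=> f; apply: lmodAut_inj. Qed.
Fact aut_mul1r : right_id aut_one aut_mul.
Proof. by move=> f; apply: lmodAut_inj. Qed.
Fact aut_mulV : left_inverse aut_one aut_inv aut_mul.
Proof. by move=> f; apply: lmodAut_inj => x /=; rewrite aut_funK. Qed.
Fact aut_mulVr : right_inverse aut_one aut_inv aut_mul.
Proof. by move=> f; apply: lmodAut_inj => x /=; rewrite aut_invfunK. Qed.

HB.instance Definition _ :=
  isGroup.Build (lmodAut V) aut_mulA aut_mul1 aut_mul1r aut_mulV aut_mulVr.

End AutomorphismGroup.

Record Hol (R : pzRingType) (V : lmodType R) := MkHol {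
  hol_aut : lmodAut V;
  hol_vec : V }.

Section Holomorph.
Variables (R : pzRingType) (V : lmodType R).
Implicit Types p q : Hol V.

HB.instance Definition _ := gen_eqMixin (Hol V).
HB.instance Definition _ := gen_choiceMixin (Hol V).

Definition hol_one : Hol V := MkHol 1%g 0.

Definition hol_inv p : Hol V :=
  MkHol (hol_aut p)^-1%g (- hol_aut p (hol_vec p)).

Definition hol_mul p q : Hol V :=
  MkHol (hol_aut p * hol_aut q)%g ((hol_aut q)^-1%g (hol_vec p) + hol_vec q).

Fact hol_mulA : associative hol_mul.
Proof.
move=> [f x] [g y] [h z]; rewrite /hol_mul /=; congr MkHol.
  by rewrite mulgA.
by rewrite linearD /= addrA.
Qed.
Fact hol_mul1 : left_id hol_one hol_mul.
Proof. by move=> [f x]; rewrite /hol_mul /= mul1g linear0 add0r. Qed.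
Fact hol_mul1r : right_id hol_one hol_mul.
Proof. by move=> [f x]; rewrite /hol_mul /= mulg1 addr0. Qed.
Fact hol_mulV : left_inverse hol_one hol_inv hol_mul.
Proof.
by move=> [f x]; rewrite /hol_mul /= mulVg linearN /= aut_funK addNr.
Qed.
Fact hol_mulVr : right_inverse hol_one hol_inv hol_mul.
Proof. by move=> [f x]; rewrite /hol_mul /= mulgV addrN. Qed.

HB.instance Definition _ :=
  isGroup.Build (Hol V) hol_mulA hol_mul1 hol_mul1r hol_mulV hol_mulVr.

End Holomorph.

Definition isomorphic_to_subgroup (G H : groupType) (S : set H) : Prop :=
  group_closed [in S] /\
  exists phi : {multiplicative G -> H}, injective phi /\ range phi = S.

(* The direct sum of m copies of R is the module 'cV[R]_m of column vectors,
   on which matrices act by multiplication on the left. By [mx_aut_bij], this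
   action is the isomorphism between GL(m, R) and the automorphism group. *)
Section MatrixAutomorphisms.
Variables (R : comPzRingType) (m : nat).
Implicit Types A B : GL R m.

Definition mx_act (M : 'M[R]_m) (x : 'cV[R]_m) : 'cV[R]_m := M *m x.

Fact mx_act_is_semilinear M : semilinear (mx_act M).
Proof. by split=> [a x|x y]; rewrite /mx_act ?scalemxAr ?mulmxDr. Qed.
HB.instance Definition _ M :=
  GRing.isSemilinear.Build R 'cV[R]_m 'cV[R]_m _ (mx_act M)
    (mx_act_is_semilinear M).

Fact mx_actK A : cancel (mx_act A) (mx_act (GL_invmx A)).
Proof. by move=> x; rewrite /mx_act mulmxA GL_mulVmx mul1mx. Qed.
Fact mx_actVK A : cancel (mx_act (GL_invmx A)) (mx_act A).
Proof. by move=> x; rewrite /mx_act mulmxA GL_mulmxV mul1mx. Qed.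

Definition mx_aut A : lmodAut 'cV[R]_m :=
  @MkLmodAut R 'cV[R]_m (mx_act A) (mx_act (GL_invmx A))
    (mx_actK A) (mx_actVK A).

Fact mx_autM : {morph mx_aut : A B / (A * B)%g}.
Proof. by move=> A B; apply: lmodAut_inj => x /=; rewrite /mx_act mulmxA. Qed.
HB.instance Definition _ :=
  isMultiplicative.Build (GL R m) (lmodAut 'cV[R]_m) mx_aut mx_autM.

Definition lin_cV_mx (f : 'cV[R]_m -> 'cV[R]_m) : 'M[R]_m :=
  \matrix_(i, j) f (delta_mx j 0) i 0.

Fact lin_cV_mxP (f : {linear 'cV[R]_m -> 'cV[R]_m}) x : lin_cV_mx f *m x = f x.
Proof.
apply/colP=> i; rewrite mxE [x in RHS]matrix_sum_delta linear_sum summxE.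
apply: eq_bigr => j _; rewrite big_ord1 linearZ /= !mxE mulrC.
by congr (_ * _).
Qed.

Lemma cV_ext (M N : 'M[R]_m) : (forall x : 'cV_m, M *m x = N *m x) -> M = N.
Proof.
by move=> e; apply/matrixP=> i j; have /colP/(_ i) := e (delta_mx j 0);
  rewrite -!colE !mxE.
Qed.

Lemma mx_aut_bij : bijective mx_aut.
Proof.
have K1 (f : lmodAut 'cV[R]_m) :
    lin_cV_mx (aut_fun f) *m lin_cV_mx (aut_invfun f) = 1%:M.
  by apply: cV_ext => x; rewrite -mulmxA !lin_cV_mxP aut_invfunK mul1mx.
have K2 (f : lmodAut 'cV[R]_m) :
    lin_cV_mx (aut_invfun f) *m lin_cV_mx (aut_fun f) = 1%:M.
  by apply: cV_ext => x; rewrite -mulmxA !lin_cV_mxP aut_funK mul1mx.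
exists (fun f => MkGL (K1 f) (K2 f)) => [A|f].
  by apply: GL_inj; apply: cV_ext => x; rewrite lin_cV_mxP.
by apply: lmodAut_inj => x /=; rewrite /mx_act lin_cV_mxP.
Qed.

End MatrixAutomorphisms.

Section BlockSubgroups.
Variables (R : comPzRingType) (n : nat).

Definition top_row_GL : set (GL R (1 + n)) :=
  [set A | exists (v : 'rV[R]_n) (M : GL R n),
     GL_mx A = block_mx (1%:M : 'M_1) v 0 (GL_mx M)].

Definition left_col_GL : set (GL R (1 + n)) :=
  [set A | exists (w : 'cV[R]_n) (M : GL R n),
     GL_mx A = block_mx (1%:M : 'M_1) 0 w (GL_mx M)].

Definition e1 : 'cV[R]_(1 + n) := delta_mx 0 0.

End BlockSubgroups.

Arguments top_row_GL R n : clear implicits.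
Arguments left_col_GL R n : clear implicits.
Arguments e1 {R n}.

(* N is the image of an injective linear map, hence a submodule, free on n
   generators. *)
Definition free_submodule_of_rank (R : pzRingType) (V : lmodType R) (n : nat)
    (N : set V) : Prop :=
  exists2 i : {linear 'cV[R]_n -> V}, injective i & range i = N.

(* The automorphisms that stabilize N and act trivially on V / N. Without the
   second condition the result would contain u *: id for every unit u of R,
   so that it could not be [left_col_GL] as soon as R has a unit u != 1. *)
Definition quotient_stabilizer (R : pzRingType) (V : lmodType R) (N : set V) :
    set (lmodAut V) :=
  [set f | f @` N = N /\ forall x, N (f x - x)].

(* Main.v *)
(** A holomorph element [(f, x)], with [M] the matrix of [f], is sent to the
    affine map [y |-> f (x + y)], whose homogeneous matrix is
    [block_mx 1 0 (M *m x) M]: this proves (2). Composing with the automorphism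
    [A |-> (A^-1)^T] of the general linear group, which sends the block lower
    triangular matrices to the block upper triangular ones, gives (1). Both
    stabilizers are read off the blocks of a matrix and of its inverse, which
    lies in the same stabilizer; the rank [n] submodule is that of the vectors
    with zero first coordinate. *)
Require Import Defs.
From HB Require Import structures.
From mathcomp Require Import all_boot all_order all_algebra.
From mathcomp Require Import boolp classical_sets.

Set Implicit Arguments.
Unset Strict Implicit.
Unset Printing Implicit Defensive.

Local Open Scope ring_scope.
Local Open Scope classical_set_scope.

Import GRing.Theory.

(** The range of a morphism is automatically closed under the group operations, so giving the map is
    enough. *)
Lemma isomorphic_to_subgroupI (G H : groupType) (S : set H) (phi : G -> H) :
  {morph phi : x y / (x * y)%g} -> injective phi -> range phi = S ->
  isomorphic_to_subgroup G S.
Proof.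
move=> phiM phi_inj <-.
pose phi_isM := isMultiplicative.Build G H phi phiM.
pose phim : {multiplicative G -> H} := HB.pack phi phi_isM.
split; last by exists phim.
(* Compatibility with division, from products alone: write [x] as [(x / y) * y]. *)
have phiF x y : phi (x / y)%g = (phi x / phi y)%g.
  by rewrite -[x in RHS](divgK y) phiM mulgK.
split; first by rewrite inE; exists 1%g; rewrite // -(divgg 1%g) phiF divgg.
move=> _ _ /set_mem[x _ <-] /set_mem[y _ <-].
by rewrite inE; exists (x / y)%g; rewrite // phiF.
Qed.

Lemma isomorphic_to_subgroup_image (G H K : groupType) (S : set H)
    (h : H -> K) :
  {morph h : x y / (x * y)%g} -> injective h ->
  isomorphic_to_subgroup G S -> isomorphic_to_subgroup G (h @` S).
Proof.
move=> hM h_inj [_ [phi [phi_inj <-]]].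
apply: (isomorphic_to_subgroupI (phi := h \o phi)).
- by move=> x y /=; rewrite gmulfM hM.
- exact: inj_comp.
- by rewrite image_comp.
Qed.

Section Contragredient.
Variables (R : comPzRingType) (n : nat).
Implicit Types A B : GL R n.

Fact contragredient_subproof A : (GL_invmx A)^T *m (GL_mx A)^T = 1%:M.
Proof. by rewrite -trmx_mul GL_mulmxV trmx1. Qed.

Fact contragredient_subproofV A : (GL_mx A)^T *m (GL_invmx A)^T = 1%:M.
Proof. by rewrite -trmx_mul GL_mulVmx trmx1. Qed.

Definition contragredient A : GL R n :=
  MkGL (contragredient_subproof A) (contragredient_subproofV A).

(** Transposition and inversion both reverse products, so their composite preserves them. *)
Lemma contragredientM : {morph contragredient : A B / (A * B)%g}.
Proof. by move=> A B; apply: GL_inj; rewrite /= trmx_mul. Qed.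

Lemma contragredientK : involutive contragredient.
Proof. by move=> A; apply: GL_inj; rewrite /= trmxK. Qed.

End Contragredient.

Section Blocks.
Variables (R : comPzRingType) (n : nat).
Implicit Types (w : 'cV[R]_n) (v : 'rV[R]_n) (M : GL R n) (A : GL R (1 + n)).

Definition left_col_mx w (M : 'M[R]_n) : 'M[R]_(1 + n) := block_mx 1%:M 0 w M.

(** This is the composition of the affine maps [y |-> M *m y + w]. *)
Lemma left_col_mxM w w' (M M' : 'M[R]_n) :
  left_col_mx w M *m left_col_mx w' M' = left_col_mx (w + M *m w') (M *m M').
Proof.
rewrite mulmx_block !mul1mx !mul0mx !mulmx0 !mulmx1 !addr0.
by rewrite add0r.
Qed.

Lemma left_col_mx1 : left_col_mx 0 1%:M = 1%:M.
Proof. by rewrite /left_col_mx -scalar_mx_block. Qed.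

Fact affine_GL_subproof w M :
  left_col_mx w (GL_mx M) *m left_col_mx (- (GL_invmx M *m w)) (GL_invmx M)
    = 1%:M.
Proof.
by rewrite left_col_mxM mulmxN mulmxA GL_mulmxV mul1mx subrr left_col_mx1.
Qed.

Fact affine_GL_subproofV w M :
  left_col_mx (- (GL_invmx M *m w)) (GL_invmx M) *m left_col_mx w (GL_mx M)
    = 1%:M.
Proof. by rewrite left_col_mxM addNr GL_mulVmx left_col_mx1. Qed.

Definition affine_GL w M : GL R (1 + n) :=
  MkGL (affine_GL_subproof w M) (affine_GL_subproofV w M).

Lemma affine_GL_inj w w' M M' :
  affine_GL w M = affine_GL w' M' -> w = w' /\ M = M'.
Proof.
move=> /(congr1 (@GL_mx _ _))/= /eq_block_mx[_ _ -> eM].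
by split=> //; apply: GL_inj.
Qed.

Lemma left_col_GLP A :
  left_col_GL R n A <-> exists w M, A = affine_GL w M.
Proof.
split=> [[w [M eA]]|[w [M ->]]]; last by exists w, M.
by exists w, M; apply: GL_inj.
Qed.

Lemma contragredient_left_col :
  @contragredient R (1 + n) @` left_col_GL R n = top_row_GL R n.
Proof.
apply/seteqP; split=> [_ [_ /left_col_GLP[w [M ->]] <-]|A [v [M eA]]].
  exists (- (GL_invmx M *m w))^T, (contragredient M).
  by rewrite /= tr_block_mx trmx1 trmx0.
exists (contragredient A); last exact: contragredientK.
apply/left_col_GLP; exists (- v *m GL_invmx M)^T, (contragredient M).
(* Nothing is known of the blocks of the inverse stored in [A], so the involution is moved to the
   other side, where only the matrix of [A] occurs. *)
rewrite -[RHS]contragredientK; congr contragredient; apply: GL_inj.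
rewrite /= eA /left_col_mx tr_block_mx !trmx1 trmx0 !trmxK.
by rewrite -mulmxN mulNmx -linearN /= opprK -trmx_mul -mulmxA GL_mulVmx mulmx1
   trmxK.
Qed.

End Blocks.

Section Stabilizers.
Variables (R : comPzRingType) (n : nat).

Lemma isomorphic_Hol_left_col :
  isomorphic_to_subgroup (Hol 'cV[R]_n) (left_col_GL R n).
Proof.
have [g mx_autK gK] := mx_aut_bij R n.
have gM : {morph g : f h / (f * h)%g} by exact: can2_gmulfM.
have gE f (x : 'cV[R]_n) : g f *m x = f x by rewrite -{2}[f]gK.
pose phi (p : Hol 'cV[R]_n) :=
  affine_GL (hol_aut p (hol_vec p)) (g (hol_aut p)).
apply: (isomorphic_to_subgroupI (phi := phi)).
(* The twist in the holomorph cancels: [f (h (h^-1 x + y)) = f x + f (h y)], the translation part of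
   the composed affine maps. *)
- move=> [f x] [h y]; apply: GL_inj => /=; rewrite left_col_mxM gM /=.
  by rewrite linearD /= aut_invfunK linearD gE.
- move=> [f x] [h y] /affine_GL_inj[/= exy /(can_inj gK) efh].
  by subst h; congr MkHol; apply: (can_inj (aut_funK f)).
- apply/seteqP; split=> [_ [p _ <-]|_ /left_col_GLP[w [M ->]]].
    by apply/left_col_GLP; do 2!eexists.
  (* The vector is the solution [x] of [M *m x = w]. *)
  exists (MkHol (mx_aut M) (GL_invmx M *m w)) => //.
  by rewrite /phi /= mx_autK /mx_act mulmxA GL_mulmxV mul1mx.
Qed.

Lemma isomorphic_Hol_top_row :
  isomorphic_to_subgroup (Hol 'cV[R]_n) (top_row_GL R n).
Proof.
rewrite -contragredient_left_col.
apply: isomorphic_to_subgroup_image isomorphic_Hol_left_col.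
  exact: contragredientM.
exact: inv_inj (@contragredientK R (1 + n)).
Qed.

(** Surjectivity of [mx_aut] turns a membership criterion for matrices into an equality of sets of
    automorphisms. *)
Lemma image_mx_aut (S : set (GL R (1 + n))) (T : set (lmodAut 'cV[R]_(1 + n))) :
  (forall A, S A <-> T (mx_aut A)) -> @mx_aut R (1 + n) @` S = T.
Proof.
move=> ST; apply/seteqP; split=> [_ [A /ST TA <-] //|f Tf].
have [g _ gK] := mx_aut_bij R (1 + n).
by exists (g f); [apply/ST|]; rewrite gK.
Qed.

Lemma e1_col : e1 = col_mx 1%:M 0 :> 'cV[R]_(1 + n).
Proof.
apply/colP=> i; rewrite mxE; case: (split_ordP i) => j ->.
  by rewrite col_mxEu !ord1 !mxE.
by rewrite col_mxEd mxE.
Qed.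

Lemma top_row_GLP (A : GL R (1 + n)) : top_row_GL R n A <-> A *m e1 = e1.
Proof.
(* [B *m e1] is the first column of [B]. *)
have block_e1 (B : 'M[R]_(1 + n)) : B *m e1 = e1 ->
    B = block_mx 1%:M (ursubmx B) 0 (drsubmx B).
  rewrite e1_col -{1}[B]submxK mul_block_col !mulmx1 !mulmx0 !addr0.
  by move=> /eq_col_mx[<- <-]; rewrite submxK.
split=> [[v [M ->]]|Ae1].
  by rewrite e1_col mul_block_col !mulmx1 !mulmx0 !addr0.
have Ve1 : GL_invmx A *m e1 = e1 by rewrite -{1}Ae1 mulmxA GL_mulVmx mul1mx.
(* As [A] and its inverse are both block upper triangular, the lower right blocks of their two
   products are the products of their lower right blocks; these blocks are thus inverse to each
   other. *)
have := GL_mulVmx A; have := GL_mulmxV A.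
rewrite (block_e1 _ Ae1) (block_e1 _ Ve1) !mulmx_block !mul0mx !add0r.
rewrite (scalar_mx_block 1 n) => /eq_block_mx[_ _ _ MV] /eq_block_mx[_ _ _ VM].
exists (ursubmx (GL_mx A)), (MkGL MV VM).
exact: block_e1.
Qed.

Definition zero_first : set 'cV[R]_(1 + n) := [set x | usubmx x = 0].

Lemma zero_first_free : free_submodule_of_rank n zero_first.
Proof.
pose i : {linear 'cV[R]_n -> 'cV[R]_(1 + n)} := mulmx (col_mx 0 1%:M).
have iE x : i x = col_mx 0 x by rewrite /i /= mul_col_mx mul0mx mul1mx.
exists i => [x y|]; first by rewrite !iE => /eq_col_mx[].
apply/seteqP; split=> [_ [x _ <-]|x x0].
  by rewrite iE /zero_first /= col_mxKu.
by exists (dsubmx x); rewrite // iE -[RHS]vsubmxK x0.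
Qed.

Lemma left_col_GL_stabP (A : GL R (1 + n)) :
  left_col_GL R n A <-> quotient_stabilizer zero_first (mx_aut A).
Proof.
(* Acting trivially modulo [zero_first] means preserving the first coordinate; testing this on the
   basis vectors gives the first row of the identity. *)
have block_stab (B : 'M[R]_(1 + n)) : (forall x, zero_first (B *m x - x)) ->
    B = block_mx 1%:M 0 (dlsubmx B) (drsubmx B).
  move=> Bx; have E : usubmx B = usubmx 1%:M.
    apply/matrixP => i j.
    have /colP/(_ i) := Bx (delta_mx j 0).
    rewrite -{2}[delta_mx j 0]mul1mx -mulmxBl -colE !mxE => /eqP.
    by rewrite subr_eq0 => /eqP.
  rewrite -[LHS]submxK /ulsubmx /ursubmx E -/(ulsubmx _) -/(ursubmx _).
  by rewrite (scalar_mx_block 1 n) block_mxKul block_mxKur.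
have block_zero w (M : 'M[R]_n) x : zero_first x ->
    left_col_mx w M *m x = col_mx 0 (M *m dsubmx x).
  by move=> x0; rewrite -{1}[x]vsubmxK x0 mul_block_col !mulmx0 mul0mx !add0r.
split=> [/left_col_GLP[w [M ->]]|[_ Af]].
  split=> [|x] /=; last first.
    rewrite /mx_act -{1}[x]vsubmxK mul_block_col mul1mx mul0mx addr0.
    by rewrite /zero_first /= linearB /= col_mxKu subrr.
  apply/seteqP; split=> [_ [x x0 <-]|x x0].
    by rewrite /= /mx_act block_zero //= /zero_first /= col_mxKu.
  (* The preimage of [x] under the inverse affine matrix. *)
  exists (left_col_mx (- (GL_invmx M *m w)) (GL_invmx M) *m x).
    by rewrite block_zero // /zero_first /= col_mxKu.
  by rewrite /= /mx_act mulmxA affine_GL_subproof mul1mx.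
(* The inverse also acts trivially on the quotient: apply [Af] to the preimage of [x] and change the
   sign. *)
have Vf x : zero_first (GL_invmx A *m x - x).
  have := Af (GL_invmx A *m x); rewrite /= /mx_act mulmxA GL_mulmxV mul1mx.
  by rewrite /zero_first /= -opprB linearN /= => /eqP; rewrite oppr_eq0 => /eqP.
have := GL_mulVmx A; have := GL_mulmxV A.
rewrite (block_stab _ Af) (block_stab _ Vf) !mulmx_block !mulmx0 !add0r.
rewrite (scalar_mx_block 1 n) => /eq_block_mx[_ _ _ MV] /eq_block_mx[_ _ _ VM].
exists (dlsubmx (GL_mx A)), (MkGL MV VM).
exact: block_stab.
Qed.

End Stabilizers.

Theorem lemma4p1p1 (R : comPzRingType) (n : nat) (n_gt0 : (0 < n)%N) :
  (isomorphic_to_subgroup (Hol 'cV[R]_n) (top_row_GL R n) /\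
   @mx_aut R (1 + n) @` top_row_GL R n =
     [set f : lmodAut 'cV[R]_(1 + n) | f e1 = e1])
  /\
  (isomorphic_to_subgroup (Hol 'cV[R]_n) (left_col_GL R n) /\
   exists N : set 'cV[R]_(1 + n),
     free_submodule_of_rank n N /\
     @mx_aut R (1 + n) @` left_col_GL R n = quotient_stabilizer N).
Proof.
split; split.
- exact: isomorphic_Hol_top_row.
- exact/image_mx_aut/top_row_GLP.
- exact: isomorphic_Hol_left_col.
- exists (@zero_first R n); split; first exact: zero_first_free.
  exact/image_mx_aut/left_col_GL_stabP.
Qed.
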